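(* Let $A=\begin{bmatrix} a & b & c\\ f & g & h\\ p & q & r\end{bmatrix}$ be a $3\times 3$ matrix with entries in the quaternions $\mathbb{H}$ such that $c\neq 0$, let $\pi_A=g-hc^{-1}b$ be its pole, and let $\mu_A\colon\mathbb{H}\to\mathbb{H}$ be the rational characteristic map of $A$ defined by $$\mu_A(\pi_A)=\left(q-(r-\pi_A)c^{-1}b\right)\left(f-hc^{-1}(a-\pi_A)\right)$$ and, for $\lambda\neq\pi_A$, $$\mu_A(\lambda)=(\pi_A-\lambda)\left[p-(r-\lambda)c^{-1}(a-\lambda)-\left(q-(r-\lambda)c^{-1}b\right)(\pi_A-\lambda)^{-1}\left(f-hc^{-1}(a-\lambda)\right)\right].$$ Then $\mu_A$ is continuous if and only if the pole $\pi_A$ is a left eigenvalue of $A$.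
   Context: A quaternion $\lambda$ is a left eigenvalue of a square quaternionic matrix $A$ if $A-\lambda\,\mathrm{Id}$ is not invertible. Continuity refers to the usual topology of $\mathbb{H}\cong\mathbb{R}^4$. *)

(* Defs.v *)
From HB Require Import structures.
From mathcomp Require Import all_boot all_order all_algebra ring.
From mathcomp Require Import all_classical reals topology normedtype.

Set Implicit Arguments.
Unset Strict Implicit.
Unset Printing Implicit Defensive.

Import Order.TTheory GRing.Theory Num.Theory.
Import numFieldNormedType.Exports.

Local Open Scope classical_set_scope.
Local Open Scope ring_scope.

(* [(x0, x1, x2, x3)] is the quaternion x0 + x1 i + x2 j + x3 k.  The additive
   structure and the (product) topology are those of R^4; the componentwise
   ring structure of the product type is not inherited. *)
Definition quat (R : realType) : Type := (R * R * R * R)%type.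

HB.instance Definition _ (R : realType) :=
  Tvs.copy (quat R) (R * R * R * R)%type.

Section Quaternion.
Variable R : realType.
Implicit Types x y z : quat R.

Definition quat_one : quat R := (1, 0, 0, 0).

Definition quat_mul x y : quat R :=
  let: (x0, x1, x2, x3) := x in
  let: (y0, y1, y2, y3) := y in
  (x0 * y0 - x1 * y1 - x2 * y2 - x3 * y3,
   x0 * y1 + x1 * y0 + x2 * y3 - x3 * y2,
   x0 * y2 - x1 * y3 + x2 * y0 + x3 * y1,
   x0 * y3 + x1 * y2 - x2 * y1 + x3 * y0).

Lemma quat_addE (x0 x1 x2 x3 y0 y1 y2 y3 : R) :
  ((x0, x1, x2, x3) : quat R) + ((y0, y1, y2, y3) : quat R) =
  (x0 + y0, x1 + y1, x2 + y2, x3 + y3).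
Proof. by []. Qed.

Lemma quat_mulA : associative quat_mul.
Proof.
move=> [[[x0 x1] x2] x3] [[[y0 y1] y2] y3] [[[z0 z1] z2] z3] /=.
by congr (_, _, _, _); ring.
Qed.

Lemma quat_mul1 : left_id quat_one quat_mul.
Proof. by move=> [[[x0 x1] x2] x3] /=; congr (_, _, _, _); ring. Qed.

Lemma quat_mulr1 : right_id quat_one quat_mul.
Proof. by move=> [[[x0 x1] x2] x3] /=; congr (_, _, _, _); ring. Qed.

Lemma quat_mulDl : left_distributive quat_mul +%R.
Proof.
move=> [[[x0 x1] x2] x3] [[[y0 y1] y2] y3] [[[z0 z1] z2] z3].
by rewrite quat_addE /= quat_addE; congr (_, _, _, _); ring.
Qed.

Lemma quat_mulDr : right_distributive quat_mul +%R.
Proof.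
move=> [[[x0 x1] x2] x3] [[[y0 y1] y2] y3] [[[z0 z1] z2] z3].
by rewrite quat_addE /= quat_addE; congr (_, _, _, _); ring.
Qed.

Lemma quat_one_neq0 : quat_one != 0.
Proof. by apply/eqP => -[/eqP]; rewrite oner_eq0. Qed.

HB.instance Definition _ := GRing.Zmodule_isNzRing.Build (quat R)
  quat_mulA quat_mul1 quat_mulr1 quat_mulDl quat_mulDr quat_one_neq0.

Lemma quat_oneE : 1 = quat_one.
Proof. by []. Qed.

Lemma quat_mulE x y : x * y = quat_mul x y.
Proof. by []. Qed.

Definition quat_normsq x : R :=
  let: (x0, x1, x2, x3) := x in x0 ^+ 2 + x1 ^+ 2 + x2 ^+ 2 + x3 ^+ 2.

Definition quat_inv x : quat R :=
  let: (x0, x1, x2, x3) := x in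
  let n := quat_normsq x in (x0 / n, - x1 / n, - x2 / n, - x3 / n).

Lemma quat_normsq_eq0 x : (quat_normsq x == 0) = (x == 0).
Proof.
case: x => [[[x0 x1] x2] x3] /=.
rewrite !paddr_eq0 ?addr_ge0 ?sqr_ge0 // !sqrf_eq0.
apply/idP/eqP => [/andP[/andP[/andP[/eqP-> /eqP->] /eqP->] /eqP->]//|].
by case=> -> -> -> ->; rewrite !eqxx.
Qed.

Lemma quat_mulVr : {in [pred x | x != 0], left_inverse 1 quat_inv *%R}.
Proof.
move=> x; rewrite inE -quat_normsq_eq0; case: x => [[[x0 x1] x2] x3] /= n0.
by rewrite quat_mulE quat_oneE /=; congr (_, _, _, _); field.
Qed.

Lemma quat_mulrV : {in [pred x | x != 0], right_inverse 1 quat_inv *%R}.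
Proof.
move=> x; rewrite inE -quat_normsq_eq0; case: x => [[[x0 x1] x2] x3] /= n0.
by rewrite quat_mulE quat_oneE /=; congr (_, _, _, _); field.
Qed.

Lemma quat_unitP x y : y * x = 1 /\ x * y = 1 -> x != 0.
Proof.
case=> yx _; apply/eqP => x0; move: yx; rewrite x0 mulr0 => /esym/eqP.
by rewrite oner_eq0.
Qed.

Lemma quat_inv_out : {in [predC [pred x : quat R | x != 0]], quat_inv =1 id}.
Proof.
move=> x; rewrite !inE negbK => /eqP ->.
by rewrite /quat_inv /= !oppr0 !mul0r.
Qed.

HB.instance Definition _ := GRing.NzRing_hasMulInverse.Build (quat R)
  quat_mulVr quat_mulrV quat_unitP quat_inv_out.

End Quaternion.

(* The library's [unitmx] is only available over commutative rings. *)
Definition mx_invertible (R : nzRingType) (n : nat) (M : 'M[R]_n) : Prop :=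
  exists N : 'M[R]_n, M *m N = 1%:M /\ N *m M = 1%:M.

Definition left_eigenvalue (R : nzRingType) (n : nat) (A : 'M[R]_n) (l : R) :
  Prop := ~ mx_invertible (A - l%:M).

Section CharacteristicMap.
Variables (R : realType) (a b c f g h p q r : quat R).

Definition mx33 : 'M[quat R]_3 :=
  \matrix_(i, j) (nth [::] [:: [:: a; b; c]; [:: f; g; h]; [:: p; q; r]] i)`_j.

Definition pole : quat R := g - h * c^-1 * b.

Definition char_map (l : quat R) : quat R :=
  if l == pole then
    (q - (r - pole) * c^-1 * b) * (f - h * c^-1 * (a - pole))
  else
    (pole - l) *
      (p - (r - l) * c^-1 * (a - l)
       - (q - (r - l) * c^-1 * b) * (pole - l)^-1
         * (f - h * c^-1 * (a - l))).

End CharacteristicMap.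

(* Main.v *)
Require Import Defs.
From HB Require Import structures.
From mathcomp Require Import all_boot all_order all_algebra ring lra.
From mathcomp Require Import all_classical reals topology normedtype.

(** Write [v l = q - (r - l) c^-1 b] and [u l = f - h c^-1 (a - l)].  Both sides
    of the equivalence amount to [v pi * u pi = 0] at the pole [pi].

    Eigenvalue side: since [g - pi = h c^-1 b], clearing the last column and
    the first row of [A - pi] with the entry [c] as pivot kills the central entry
    too, and leaves a matrix whose only possibly nonzero entries are [c], [u pi],
    [v pi] and one entry below [u pi].  So [A - pi] is invertible exactly when
    [u pi] and [v pi] are both nonzero ([double_elimination],
    [double_eliminationN]), and quaternions have no zero divisors.

    Analytic side: away from [pi] the map is a rational expression with invertible
    denominator, hence continuous.  With [d = pi - l], for [l != pi] it is
    [d * (p - (r - l) c^-1 (a - l)) - d * v l * d^-1 * u l], whose first term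
    tends to 0 as [l] tends to [pi].
    - If [l] tends to [pi] with [d] real, then [d] is central and the second term is
      just [- v l * u l]: the map tends to [- v pi * u pi], whereas its value at
      the pole is [v pi * u pi].  Continuity therefore forces [v pi * u pi = 0].
    - Conversely, conjugation by [d] preserves the norm, so the second term
      has the norm of [v l * u l]; it tends to 0 when [v pi * u pi = 0],
      although the conjugation itself has no limit. *)

Set Implicit Arguments.
Unset Strict Implicit.
Unset Printing Implicit Defensive.

Import Order.TTheory GRing.Theory Num.Theory.
Import numFieldNormedType.Exports.
Local Open Scope classical_set_scope.
Local Open Scope ring_scope.

(** * Quaternion norm and real quaternions *)

Section QuaternionAlgebra.
Variable R : realType.
Implicit Types x y : quat R.

Lemma quat_unitE x : (x \is a GRing.unit) = (x != 0).
Proof. by []. Qed.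

Lemma quat_normsqM x y : quat_normsq (x * y) = quat_normsq x * quat_normsq y.
Proof.
by case: x y => [[[x0 x1] x2] x3] [[[y0 y1] y2] y3]; rewrite quat_mulE /=; ring.
Qed.

Lemma quat_mul_eq0 x y : (x * y == 0) = (x == 0) || (y == 0).
Proof. by rewrite -!quat_normsq_eq0 quat_normsqM mulf_eq0. Qed.

Lemma quat_normsq_conj x y :
  x != 0 -> quat_normsq (x * y * x^-1) = quat_normsq y.
Proof.
move=> x0; rewrite !quat_normsqM mulrAC -quat_normsqM divrr ?quat_unitE //.
by rewrite quat_oneE /=; ring.
Qed.

Lemma quat_eqN_eq0 x : x = - x -> x = 0.
Proof.
case: x => [[[x0 x1] x2] x3] [e0 e1 e2 e3].
by congr (_, _, _, _); lra.
Qed.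

Definition quat_real (t : R) : quat R := (t, 0, 0, 0).

Lemma quat_real_comm t x : quat_real t * x = x * quat_real t.
Proof.
by case: x => [[[x0 x1] x2] x3]; rewrite !quat_mulE /=; congr (_, _, _, _); ring.
Qed.

Lemma quat_real_eq0 t : (quat_real t == 0) = (t == 0).
Proof. by apply/eqP/eqP => [[]|->]. Qed.

End QuaternionAlgebra.

(** * Limits of quaternion-valued functions *)

Section QuaternionLimits.
Variables (R : realType) (T : Type) (F : set_system T).
Context {FF : Filter F}.
Implicit Types (f g : T -> quat R) (x y : quat R).

(** The topology is that of the product, so limits are taken coordinatewise; the
    continuity of the quaternion operations reduces to that of polynomials and
    quotients of reals. *)
Lemma cvg_quatP f x : f t @[t --> F] --> x <->
  [/\ (f t).1.1.1 @[t --> F] --> x.1.1.1, (f t).1.1.2 @[t --> F] --> x.1.1.2,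
      (f t).1.2 @[t --> F] --> x.1.2 & (f t).2 @[t --> F] --> x.2].
Proof.
split=> [fx|[f0 f1 f2 f3]].
- have f1 : (f t).1 @[t --> F] --> x.1 by apply: cvg_comp fx _; exact: cvg_fst.
  have f11 : (f t).1.1 @[t --> F] --> x.1.1.
    by apply: cvg_comp f1 _; exact: cvg_fst.
  split.
  + by apply: cvg_comp f11 _; exact: cvg_fst.
  + by apply: cvg_comp f11 _; exact: cvg_snd.
  + by apply: cvg_comp f1 _; exact: cvg_snd.
  + by apply: cvg_comp fx _; exact: cvg_snd.
- have -> : f = fun t => ((f t).1.1.1, (f t).1.1.2, (f t).1.2, (f t).2).
    by apply/funext => t; case: (f t) => [[[? ?] ?] ?].
  case: x f0 f1 f2 f3 => [[[x0 x1] x2] x3] /= f0 f1 f2 f3.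
  exact: cvg_pair (cvg_pair (cvg_pair f0 f1) f2) f3.
Qed.

Lemma cvg_quatB f g x y : f t @[t --> F] --> x -> g t @[t --> F] --> y ->
  f t - g t @[t --> F] --> x - y.
Proof. by move=> fx gy; exact: cvgB. Qed.


Lemma cvg_quatM f g x y : f t @[t --> F] --> x -> g t @[t --> F] --> y ->
  f t * g t @[t --> F] --> x * y.
Proof.
move=> /cvg_quatP[f0 f1 f2 f3] /cvg_quatP[g0 g1 g2 g3].
have mulE u v : u * v = (u.1.1.1 * v.1.1.1 - u.1.1.2 * v.1.1.2
      - u.1.2 * v.1.2 - u.2 * v.2,
    u.1.1.1 * v.1.1.2 + u.1.1.2 * v.1.1.1 + u.1.2 * v.2 - u.2 * v.1.2,
    u.1.1.1 * v.1.2 - u.1.1.2 * v.2 + u.1.2 * v.1.1.1 + u.2 * v.1.1.2,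
    u.1.1.1 * v.2 + u.1.1.2 * v.1.2 - u.1.2 * v.1.1.2 + u.2 * v.1.1.1) :> quat R.
  by case: u v => [[[? ?] ?] ?] [[[? ?] ?] ?].
rewrite mulE; under eq_fun do rewrite mulE.
by apply/cvg_quatP; split=> /=; repeat first [apply: cvgB | apply: cvgD | apply: cvgM].
Qed.

Lemma cvg_quat_normsq f x : f t @[t --> F] --> x ->
  quat_normsq (f t) @[t --> F] --> quat_normsq x.
Proof.
move=> /cvg_quatP[f0 f1 f2 f3].
have normsqE u : quat_normsq u = u.1.1.1 * u.1.1.1 + u.1.1.2 * u.1.1.2
    + u.1.2 * u.1.2 + u.2 * u.2 by case: u => [[[? ?] ?] ?].
rewrite normsqE; under eq_fun do rewrite normsqE.
by repeat first [apply: cvgD | apply: cvgM].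
Qed.

Lemma cvg_quatV f x : x != 0 -> f t @[t --> F] --> x ->
  (f t)^-1 @[t --> F] --> x^-1.
Proof.
move=> x0 fx; have /cvg_quatP[f0 f1 f2 f3] := fx.
have invE u : u^-1 = (u.1.1.1 / quat_normsq u, - u.1.1.2 / quat_normsq u,
    - u.1.2 / quat_normsq u, - u.2 / quat_normsq u) :> quat R.
  by case: u => [[[? ?] ?] ?].
have fV : (quat_normsq (f t))^-1 @[t --> F] --> (quat_normsq x)^-1.
  by apply: cvgV; [rewrite quat_normsq_eq0 | exact: cvg_quat_normsq].
rewrite invE; under eq_fun do rewrite invE.
by apply/cvg_quatP; split=> /=; apply: cvgM => //; apply: cvgN.
Qed.

(** Convergence to 0 can be read on the norm alone, which is what makes conjugation
    by an uncontrolled quaternion harmless. *)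
Lemma cvg_quat0 f : quat_normsq (f t) @[t --> F] --> 0 -> f t @[t --> F] --> 0.
Proof.
move=> f0.
have sqr0 (k : T -> R) : (forall t, k t ^+ 2 <= quat_normsq (f t)) ->
    k t @[t --> F] --> 0.
  move=> kf; apply/cvgr0Pnorm_lt => e e0.
  have e2 : 0 < e ^+ 2 by rewrite exprn_gt0.
  near=> t; rewrite -(@ltr_pXn2r _ 2) ?nnegrE ?(ltW e0)// real_normK ?num_real//.
  apply: le_lt_trans (kf t) _; near: t.
  move/cvgr0Pnorm_lt: f0 => /(_ _ e2); apply: filterS => t.
  exact: le_lt_trans (ler_norm _).
have := fun t => (sqr_ge0 (f t).1.1.1, sqr_ge0 (f t).1.1.2, sqr_ge0 (f t).1.2,
  sqr_ge0 (f t).2).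
move=> ge0; apply/cvg_quatP; split; apply: sqr0 => t; move: (ge0 t);
  by case: (f t) => [[[x0 x1] x2] x3] /= [[[]]]; lra.
Unshelve. all: by end_near. Qed.

End QuaternionLimits.

Lemma cvg_sub_quat_real (R : realType) (x : quat R) :
  x - quat_real t @[t --> (0 : R)^'] --> x.
Proof.
rewrite -[X in _ --> X]subr0; apply: cvg_quatB; first exact: cvg_cst.
apply/cvg_quatP; split=> /=; [|exact: cvg_cst..].
exact: (@cvg_within R (nbhs 0)).
Qed.

(** * Invertible matrices over a noncommutative ring *)

Section Matrices.
Variable K : nzRingType.

Lemma mx_invertible_mul n (M N : 'M[K]_n) :
  mx_invertible M -> mx_invertible N -> mx_invertible (M *m N).
Proof.
move=> [M' [MM' M'M]] [N' [NN' N'N]]; exists (N' *m M'); split.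
- by rewrite mulmxA -(mulmxA M) NN' mulmx1.
- by rewrite mulmxA -(mulmxA N') M'M mulmx1.
Qed.

Lemma mx_invertible_mull0 m n (M : 'M[K]_n) (x : 'M_(m, n)) :
  mx_invertible M -> x *m M = 0 -> x = 0.
Proof. by move=> [N [MN _]] xM; rewrite -[x]mulmx1 -MN mulmxA xM mul0mx. Qed.

Lemma mx_invertible_mulr0 m n (M : 'M[K]_n) (x : 'M_(n, m)) :
  mx_invertible M -> M *m x = 0 -> x = 0.
Proof. by move=> [N [_ NM]] Mx; rewrite -[x]mul1mx -NM -mulmxA Mx mulmx0. Qed.

Definition mx3 (rows : seq (seq K)) : 'M[K]_3 :=
  \matrix_(i, j) (nth [::] rows i)`_j.

Lemma mulmx3 (A B : seq (seq K)) : mx3 A *m mx3 B =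
  mx3 [seq [seq (nth [::] A i)`_0 * (nth [::] B 0)`_j +
            (nth [::] A i)`_1 * (nth [::] B 1)`_j +
            (nth [::] A i)`_2 * (nth [::] B 2)`_j | j <- iota 0 3] | i <- iota 0 3].
Proof.
apply/matrixP => i j; rewrite !mxE !big_ord_recl big_ord0 !mxE /= addr0 addrA.
by case: i => [[|[|[|//]]] ?]; case: j => [[|[|[|//]]] ?].
Qed.

Lemma mx3_1 : 1%:M = mx3 [:: [:: 1; 0; 0]; [:: 0; 1; 0]; [:: 0; 0; 1]].
Proof.
apply/matrixP => i j; rewrite !mxE.
by case: i => [[|[|[|//]]] ?]; case: j => [[|[|[|//]]] ?].
Qed.

(** With [x] and [z] not both nonzero the lower part squares to zero, so the
    inverse is obtained by changing signs. *)
Lemma lower_unipotent_invertible (x y z : K) : x = 0 \/ z = 0 ->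
  mx_invertible (mx3 [:: [:: 1; 0; 0]; [:: x; 1; 0]; [:: y; z; 1]]).
Proof.
move=> xz; have xz0 : z * x = 0 by case: xz => ->; rewrite ?(mul0r, mulr0).
exists (mx3 [:: [:: 1; 0; 0]; [:: - x; 1; 0]; [:: - y; - z; 1]]).
by split; rewrite mulmx3 mx3_1 /= !(mulr1, mul1r, mulr0, mul0r, addr0, add0r)
  ?mulrN ?mulNr ?xz0 ?oppr0 ?addr0 ?subrr ?addNr.
Qed.
End Matrices.

Section DoubleElimination.
Variables (K : unitRingType) (a b c f h p q r : K).
Hypothesis cU : c \is a GRing.unit.
Let u := f - h * c^-1 * a.
Let v := q - r * c^-1 * b.
Let M := mx3 [:: [:: a; b; c]; [:: f; h * c^-1 * b; h]; [:: p; q; r]].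

(** The factorization records the elimination with pivot [c]: the left factor
    undoes the row operations that clear the last column, the right one undoes
    the column operations that clear the first row.  The central entry
    [h * c^-1 * b] of [M] is exactly the one that both operations turn into 0. *)
Lemma double_elimination : u \is a GRing.unit -> v \is a GRing.unit ->
  mx_invertible M.
Proof.
move=> uU vU; pose w := p - r * c^-1 * a.
have -> : M = mx3 [:: [:: 1; 0; 0]; [:: h * c^-1; 1; 0]; [:: r * c^-1; 0; 1]]
    *m mx3 [:: [:: 0; 0; c]; [:: u; 0; 0]; [:: w; v; 0]]
    *m mx3 [:: [:: 1; 0; 0]; [:: 0; 1; 0]; [:: c^-1 * a; c^-1 * b; 1]].
  rewrite !mulmx3 /= !(mulr1, mul1r, mulr0, mul0r, addr0, add0r) !mulrA.
  by rewrite mulrV // !mulrVK // !mul1r !subrK.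
apply: mx_invertible_mul; first apply: mx_invertible_mul.
- by apply: lower_unipotent_invertible; right.
- exists (mx3 [:: [:: 0; u^-1; 0]; [:: 0; - (v^-1 * w * u^-1); v^-1];
               [:: c^-1; 0; 0]]).
  by split; rewrite mulmx3 mx3_1 /= !(mulr1, mul1r, mulr0, mul0r, addr0, add0r)
    ?mulrN ?mulNr ?mulrA ?mulrVK ?mulrV ?mulVr ?mul1r ?subrr ?addNr.
- by apply: lower_unipotent_invertible; left.
Qed.

(** If [u = 0], the second row of [M] is [h * c^-1] times the first one; if
    [v = 0], the second column is the last one times [c^-1 * b].  Either relation
    gives a nonzero vector in a kernel of [M]. *)
Lemma double_eliminationN : mx_invertible M -> u != 0 /\ v != 0.
Proof.
move=> MI; split; apply/eqP => z0.
- pose x : 'rV_3 := \row_j [:: - (h * c^-1); 1; 0]`_j.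
  have : x *m M = 0.
    apply/matrixP => i j; rewrite !mxE !big_ord_recl big_ord0 !mxE /=.
    case: j => [[|[|[|//]]] ?] /=; rewrite mul1r mul0r !addr0 mulNr.
    + by rewrite addrC.
    + by rewrite addNr.
    + by rewrite mulrVK // addNr.
  move/(mx_invertible_mull0 MI)/matrixP/(_ 0 1); rewrite !mxE /= => /eqP.
  by rewrite oner_eq0.
- pose x : 'cV_3 := \col_i [:: 0; 1; - (c^-1 * b)]`_i.
  have : M *m x = 0.
    apply/matrixP => i j; rewrite !mxE !big_ord_recl big_ord0 !mxE /=.
    case: i => [[|[|[|//]]] ?] /=; rewrite mulr1 mulr0 addr0 add0r mulrN mulrA.
    + by rewrite mulrV // mul1r subrr.
    + by rewrite subrr.
    + exact: z0.
  move/(mx_invertible_mulr0 MI)/matrixP/(_ 1 0); rewrite !mxE /= => /eqP.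
  by rewrite oner_eq0.
Qed.
End DoubleElimination.

(** * Behaviour of the characteristic map at the pole *)

Section PoleContinuity.
Variables (R : realType) (a b c f g h p q r : quat R).
Local Notation mu := (char_map a b c f g h p q r).
Local Notation pi := (pole b c g h).
Local Notation left_factor l := (q - (r - l) * c^-1 * b).
Local Notation right_factor l := (f - h * c^-1 * (a - l)).
Local Notation reg l := (p - (r - l) * c^-1 * (a - l)).

Lemma char_map_poleN l : l != pi -> mu l =
  (pi - l) * reg l - (pi - l) * (left_factor l * (pi - l)^-1 * right_factor l).
Proof. by move=> /negPf lpi; rewrite /char_map lpi mulrBr. Qed.

Let sub_pole_neq0 l : l != pi -> pi - l != 0.
Proof. by rewrite subr_eq0 eq_sym. Qed.

Lemma cvg_char_map_factors T (F : set_system T) (FF : Filter F)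
    (s : T -> quat R) l : s t @[t --> F] --> l ->
  [/\ pi - s t @[t --> F] --> pi - l, reg (s t) @[t --> F] --> reg l,
      left_factor (s t) @[t --> F] --> left_factor l &
      right_factor (s t) @[t --> F] --> right_factor l].
Proof.
move=> sl; have cst (x : quat R) : x @[_ --> F] --> x by exact: cvg_cst.
by split; repeat first [exact: cst | exact: sl | apply: cvg_quatB | apply: cvg_quatM].
Qed.

Lemma char_map_continuous_off_pole l : l != pi -> {for l, continuous mu}.
Proof.
move=> lpi.
have npi : \near l, l != pi.
  have : nbhs l (~` [set pi]).
    apply: open_nbhs_nbhs; split; last by move/eqP: lpi.
    apply: closed_openC; apply: accessible_closed_set1.
    exact: hausdorff_accessible (@norm_hausdorff _ (quat R)).
  by apply: filterS => z /eqP.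
have [d0 s0 v0 u0] := cvg_char_map_factors _ (@cvg_id _ (nbhs l)).
rewrite /prop_for /continuous_at char_map_poleN //.
apply: (cvg_trans (near_eq_cvg (f := fun z => (pi - z) * reg z -
    (pi - z) * (left_factor z * (pi - z)^-1 * right_factor z)) _)).
  by apply: filterS npi => z /char_map_poleN.
apply: cvg_quatB; apply: cvg_quatM => //; apply: cvg_quatM => //.
by apply: cvg_quatM => //; apply: cvg_quatV => //; exact: sub_pole_neq0.
Qed.

Lemma char_map_pole : mu pi = left_factor pi * right_factor pi.
Proof. by rewrite /char_map eqxx. Qed.

(** On the real line through the pole, [pi - l] is central and cancels against
    its inverse in the singular term. *)
Lemma char_map_real_approach :
  mu (pi - quat_real t) @[t --> (0 : R)^'] -->
  - (left_factor pi * right_factor pi).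
Proof.
pose s t := pi - quat_real t.
have s0 : s t @[t --> (0 : R)^'] --> pi by exact: cvg_sub_quat_real.
have [d0 e0 v0 u0] := cvg_char_map_factors _ s0.
have -> : - (left_factor pi * right_factor pi) =
    (pi - pi) * reg pi - left_factor pi * right_factor pi.
  by rewrite subrr mul0r sub0r.
have dE t : pi - s t = quat_real t by rewrite /s opprB addrC subrK.
apply: (cvg_trans (near_eq_cvg (f := fun t => (pi - s t) * reg (s t) -
    left_factor (s t) * right_factor (s t)) _)).
  near=> t; have t0 : t != 0 by near: t; exact: nbhs_dnbhs_neq.
  have spi : s t != pi.
    by rewrite eq_sym -subr_eq0 dE quat_real_eq0.
  rewrite [RHS]char_map_poleN //; congr (_ - _); rewrite dE.
  by rewrite !mulrA quat_real_comm mulrK // quat_unitE quat_real_eq0.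
by apply: cvg_quatB; apply: cvg_quatM.
Unshelve. all: by end_near. Qed.

(** If the map is continuous, its limit along the real direction is its value, so
    [v u = - v u]; if [v u = 0], the singular term is small because its norm is that
    of [v l * u l], conjugation by [pi - l] being an isometry. *)
Lemma char_map_continuous_pole :
  {for pi, continuous mu} <-> left_factor pi * right_factor pi = 0.
Proof.
split=> [mu0|vu0].
- apply: quat_eqN_eq0; rewrite -{1}char_map_pole.
  apply: (cvg_unique (@norm_hausdorff _ (quat R)) _ char_map_real_approach).
  exact: cvg_comp (@cvg_sub_quat_real _ pi) mu0.
- apply/continuous_withinNx; rewrite char_map_pole vu0.
  have -> : 0 = (pi - pi) * reg pi - 0 by rewrite subrr mul0r subr0.
  have id0 : z @[z --> pi^'] --> pi by exact: (@cvg_within _ (nbhs pi)).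
  have [d0 e0 v0 u0] := cvg_char_map_factors _ id0.
  apply: (cvg_trans (near_eq_cvg (f := fun z => (pi - z) * reg z -
    (pi - z) * (left_factor z * (pi - z)^-1 * right_factor z)) _)).
    near=> z; apply/esym/char_map_poleN; near: z; exact: nbhs_dnbhs_neq.
  apply: cvg_quatB; first exact: cvg_quatM.
  apply: cvg_quat0.
  apply: (cvg_trans (near_eq_cvg
      (f := fun z => quat_normsq (left_factor z * right_factor z)) _)).
    near=> z; have zpi : z != pi by near: z; exact: nbhs_dnbhs_neq.
    rewrite !mulrA quat_normsqM [RHS]quat_normsqM quat_normsq_conj //.
    exact: sub_pole_neq0.
  have -> : 0 = quat_normsq (left_factor pi * right_factor pi) :> R.
    by apply/esym/eqP; rewrite quat_normsq_eq0 vu0.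
  by apply: cvg_quat_normsq; exact: cvg_quatM.
Unshelve. all: by end_near. Qed.

Lemma char_map_continuous :
  continuous mu <-> left_factor pi * right_factor pi = 0.
Proof.
rewrite -char_map_continuous_pole; split=> [mu_cont|mu_pi l]; first exact: mu_cont.
by have [->//|] := eqVneq l pi; exact: char_map_continuous_off_pole.
Qed.

Lemma left_eigenvalue_pole : c != 0 ->
  left_eigenvalue (mx33 a b c f g h p q r) pi <->
  left_factor pi * right_factor pi = 0.
Proof.
move=> c0; rewrite /left_eigenvalue.
have -> : mx33 a b c f g h p q r - pi%:M =
    mx3 [:: [:: a - pi; b; c]; [:: f; h * c^-1 * b; h]; [:: p; q; r - pi]].
  apply/matrixP => i j; rewrite !mxE.
  case: i => [[|[|[|//]]] ?]; case: j => [[|[|[|//]]] ?] //=; rewrite ?subr0 //.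
  by rewrite mulr1n /pole opprB addrC subrK.
have cU : c \is a GRing.unit by rewrite quat_unitE.
split=> [nI|vu0 /(double_eliminationN cU)[u0 v0]].
- apply/eqP; apply: contra_notT nI; rewrite quat_mul_eq0 negb_or => /andP[v0 u0].
  exact: double_elimination.
- by move/eqP: vu0; rewrite quat_mul_eq0 (negPf u0) (negPf v0).
Qed.
End PoleContinuity.

Theorem theorem39 (R : realType) (a b c f g h p q r : quat R) (hc : c != 0) :
  continuous (char_map a b c f g h p q r) <->
  left_eigenvalue (mx33 a b c f g h p q r) (pole b c g h).
Proof. by rewrite char_map_continuous left_eigenvalue_pole. Qed.
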